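(* Let $f\colon\mathbb{F}\to\mathbb{H}$ be a surjective hyperfield homomorphism from an algebraically closed field $\mathbb{F}$ to a stringent hyperfield $\mathbb{H}$. Then $f$ is relatively algebraically closed.
   Context: **Hyperfields.** A hyperoperation on a set $H$ is a map $\boxplus$ from $H\times H$ to the non-empty subsets of $H$; for subsets, $A\boxplus B=\bigcup_{a\in A,b\in B}a\boxplus b$, singletons are identified with their elements, and longer hypersums are obtained by iteration. A hyperfield is a tuple $(\mathbb{H},\boxplus,\odot,0_{\mathbb H},1_{\mathbb H})$ such that: $\boxplus$ is an associative and commutative hyperoperation; $0_{\mathbb H}\boxplus a=a$; each $a$ has a unique $-a$ with $0_{\mathbb H}\in a\boxplus(-a)$; $a\in b\boxplus c$ iff $c\in a\boxplus(-b)$; $\mathbb{H}^\times:=\mathbb{H}\setminus\{0_{\mathbb H}\}$ is an abelian group under the single-valued operation $\odot$ with identity $1_{\mathbb H}$; $a\odot(b\boxplus c)=(a\odot b)\boxplus(a\odot c)$; and $0_{\mathbb H}\odot a=0_{\mathbb H}$. Every field is a hyperfield with $a\boxplus b=\{a+b\}$. **Stringent.** $\mathbb{H}$ is stringent if $a\boxplus b$ is a non-singleton set only when $a=-b$ (i.e. $a\boxplus b$ is a singleton whenever $a\neq-b$). **Homomorphisms.** A hyperfield homomorphism $f\colon\mathbb{H}_1\to\mathbb{H}_2$ is a map with $f(a\boxplus_1 b)\subseteq f(a)\boxplus_2 f(b)$, $f(a\odot_1 b)=f(a)\odot_2 f(b)$, $f(0)=0$, $f(1)=1$. **Univariate polynomials.**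 $\mathbb{H}[X]$ is the set of formal expressions $p=\boxplus_{d\in D}c_d\odot X^d$ with $D\subset\mathbb{Z}_{\ge0}$ finite and $c_d\in\mathbb{H}^\times$; $p(a)=\boxplus_{d\in D}c_d\odot a^d\subseteq\mathbb{H}$; $V(p)=\{a\in\mathbb{H}\mid 0_{\mathbb H}\in p(a)\}$ is the set of roots. The push-forward along $f$ is $f_*(p)=\boxplus_{d\in D}f(c_d)\odot X^d$. **RAC.** A surjective hyperfield homomorphism $f\colon\mathbb{H}_1\to\mathbb{H}_2$ is relatively algebraically closed if for every univariate polynomial $p\in\mathbb{H}_1[X]$ and every root $\beta\in V(f_*(p))$ there exists $\alpha\in f^{-1}(\beta)$ with $\alpha\in V(p)$. *)

(* Defs.v *)
From mathcomp Require Import all_boot all_algebra finmap.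
From mathcomp Require Import boolp classical_sets functions.

Set Implicit Arguments.
Unset Strict Implicit.
Unset Printing Implicit Defensive.

Import GRing.Theory.
Local Open Scope classical_set_scope.

Definition hyperop (H : Type) := H -> H -> set H.

Definition hyperop_set (H : Type) (op : hyperop H) (A B : set H) : set H :=
  \bigcup_(a in A) \bigcup_(b in B) op a b.

Record hyperfield := Hyperfield {
  hf_sort :> Type;
  hadd : hyperop hf_sort;
  hmul : hf_sort -> hf_sort -> hf_sort;
  hzero : hf_sort;
  hone : hf_sort;
  hopp : hf_sort -> hf_sort;
  hadd_nonempty : forall a b, hadd a b !=set0;
  haddA : forall a b c,
    hyperop_set hadd (hadd a b) [set c] = hyperop_set hadd [set a] (hadd b c);
  haddC : forall a b, hadd a b = hadd b a;
  hadd0 : forall a, hadd hzero a = [set a];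
  (* both existence and uniqueness of the opposite *)
  hoppP : forall a b, hadd a b hzero <-> b = hopp a;
  hadd_rev : forall a b c, hadd b c a <-> hadd a (hopp b) c;
  hone_neq0 : hone <> hzero;
  hmul_neq0 : forall a b, a <> hzero -> b <> hzero -> hmul a b <> hzero;
  hmulA : forall a b c, a <> hzero -> b <> hzero -> c <> hzero ->
    hmul a (hmul b c) = hmul (hmul a b) c;
  hmulC : forall a b, a <> hzero -> b <> hzero -> hmul a b = hmul b a;
  hmul1 : forall a, a <> hzero -> hmul hone a = a;
  hmulV : forall a, a <> hzero -> exists2 b, b <> hzero & hmul a b = hone;
  hmul_addr : forall a b c, hmul a @` hadd b c = hadd (hmul a b) (hmul a c);
  hmul0 : forall a, hmul hzero a = hzero
}.

Arguments hadd {h}.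
Arguments hmul {h}.
Arguments hzero {h}.
Arguments hone {h}.
Arguments hopp {h}.

Definition stringent (H : hyperfield) : Prop :=
  forall a b : H, a <> hopp b -> exists c, hadd a b = [set c].

Section FieldHyperfield.
Local Open Scope ring_scope.
Variable F : fieldType.

Definition field_hadd : hyperop F := fun a b => [set a + b].

Fact field_hadd_nonempty (a b : F) : field_hadd a b !=set0.
Proof. by exists (a + b). Qed.

Fact field_haddA (a b c : F) :
  hyperop_set field_hadd (field_hadd a b) [set c] =
  hyperop_set field_hadd [set a] (field_hadd b c).
Proof. by rewrite /hyperop_set /field_hadd !bigcup_set1 addrA. Qed.

Fact field_haddC (a b : F) : field_hadd a b = field_hadd b a.
Proof. by rewrite /field_hadd addrC. Qed.

Fact field_hadd0 (a : F) : field_hadd 0 a = [set a].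
Proof. by rewrite /field_hadd add0r. Qed.

Fact field_hoppP (a b : F) : field_hadd a b 0 <-> b = - a.
Proof.
rewrite /field_hadd; split=> [/= /esym/eqP | ->]; last by rewrite subrr.
by rewrite addrC addr_eq0 => /eqP.
Qed.

Fact field_hadd_rev (a b c : F) : field_hadd b c a <-> field_hadd a (- b) c.
Proof.
rewrite /field_hadd; split=> /= ->; first by rewrite addrAC subrr add0r.
by rewrite addrC subrK.
Qed.

Fact field_hone_neq0 : (1 : F) <> 0.
Proof. by apply/eqP; exact: oner_neq0. Qed.

Fact field_hmul_neq0 (a b : F) : a <> 0 -> b <> 0 -> a * b <> 0.
Proof. by move=> /eqP a0 /eqP b0; apply/eqP; rewrite mulf_neq0. Qed.

Fact field_hmulV (a : F) : a <> 0 -> exists2 b, b <> 0 & a * b = 1.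
Proof.
by move=> /eqP a0; exists a^-1; [apply/eqP; rewrite invr_eq0 | rewrite divff].
Qed.

Fact field_hmul_addr (a b c : F) :
  *%R a @` field_hadd b c = field_hadd (a * b) (a * c).
Proof. by rewrite /field_hadd image_set1 mulrDr. Qed.

Definition field_hyperfield : hyperfield :=
  @Hyperfield F field_hadd *%R 0 1 -%R field_hadd_nonempty field_haddA
    field_haddC field_hadd0 field_hoppP field_hadd_rev field_hone_neq0
    field_hmul_neq0 (fun a b c _ _ _ => mulrA a b c)
    (fun a b _ _ => mulrC a b) (fun a _ => mul1r a) field_hmulV
    field_hmul_addr (@mul0r F).

End FieldHyperfield.

Record hyperfield_hom (H1 H2 : hyperfield) := HyperfieldHom {
  hf_fun :> H1 -> H2;
  hf_hadd : forall a b, hf_fun @` hadd a b `<=` hadd (hf_fun a) (hf_fun b);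
  hf_hmul : forall a b, hf_fun (hmul a b) = hmul (hf_fun a) (hf_fun b);
  hf_hzero : hf_fun hzero = hzero;
  hf_hone : hf_fun hone = hone
}.

Lemma hyperfield_hom_neq0 (H1 H2 : hyperfield) (f : hyperfield_hom H1 H2)
  (a : H1) : a <> hzero -> f a <> hzero.
Proof.
move=> a0 fa0; have [b _ ab1] := hmulV a0.
by apply: (@hone_neq0 H2); rewrite -(hf_hone f) -ab1 hf_hmul fa0 hmul0.
Qed.

(* The empty hypersum is {0}; by commutativity and associativity, the order *)
(* of the summands is irrelevant.                                           *)
Definition hsum (H : hyperfield) (s : seq H) : set H :=
  foldr (fun a A => hyperop_set hadd [set a] A) [set hzero] s.

(* In particular a ^ 0 = 1, including for a = 0. *)
Definition hexp (H : hyperfield) (a : H) (n : nat) : H := iter n (hmul a) hone.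

Record hpoly (H : hyperfield) := HPoly {
  hp_supp : {fset nat};
  hp_coef : hp_supp -> H;
  hp_coef_neq0 : forall d, hp_coef d <> hzero
}.

Definition hp_eval (H : hyperfield) (p : hpoly H) (a : H) : set H :=
  hsum [seq hmul (hp_coef d) (hexp a (val d)) | d : hp_supp p].

Definition hp_roots (H : hyperfield) (p : hpoly H) : set H :=
  [set a | hp_eval p a hzero].

Definition hp_push (H1 H2 : hyperfield) (f : hyperfield_hom H1 H2)
    (p : hpoly H1) : hpoly H2 :=
  @HPoly H2 (hp_supp p) (f \o @hp_coef H1 p)
    (fun d => hyperfield_hom_neq0 (f := f) (@hp_coef_neq0 H1 p d)).

Definition surjective_hom (H1 H2 : hyperfield) (f : hyperfield_hom H1 H2) :
  Prop := set_surj [set: H1] [set: H2] f.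

Definition relatively_algebraically_closed (H1 H2 : hyperfield)
    (f : hyperfield_hom H1 H2) : Prop :=
  surjective_hom f /\
  forall (p : hpoly H1) (b : H2), hp_roots (hp_push f p) b ->
    exists2 a, (f @^-1` [set b]) a & hp_roots p a.

(* Main.v *)
Require Import Defs.
From mathcomp Require Import all_boot all_algebra.
From HB Require Import structures.
From mathcomp Require Import finmap boolp classical_sets functions.

(** If no root [r] of [p] has [f r = b], then the hypersum [f_*(p)(b)] is
    contained in a nonzero singleton, so [b] is not a root of [f_*(p)].  This is
    seen by splitting off linear factors: for [p = q * (X - r)] with
    [f_*(q)(b)] inside [{s}], the relation [p_i = q_(i-1) - r q_i] gives
    [f_*(p)(b)] inside [b s - f(r) s = s (b - f(r))], and [b - f(r)] is a nonzero
    singleton because [H] is stringent and [f r <> b]. *)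

Set Implicit Arguments.
Unset Strict Implicit.
Unset Printing Implicit Defensive.

Import GRing.Theory.
Local Open Scope classical_set_scope.
Local Open Scope ring_scope.

(** * Hypersums of subsets as a commutative monoid *)

Section SetHypersum.
Variable H : hyperfield.

Definition hadd_set : set H -> set H -> set H := hyperop_set hadd.

Lemma hadd_setP (A B : set H) x :
  hadd_set A B x <-> exists a b, [/\ A a, B b & hadd a b x].
Proof.
split=> [[a Aa [b Bb abx]]|[a [b [Aa Bb abx]]]]; first by exists a, b.
by exists a => //; exists b.
Qed.

Lemma hadd_set1 a b : hadd_set [set a] [set b] = hadd a b.
Proof. by rewrite /hadd_set /hyperop_set !bigcup_set1. Qed.

Lemma hadd_setS A A' B B' :
  A `<=` A' -> B `<=` B' -> hadd_set A B `<=` hadd_set A' B'.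
Proof.
move=> sA sB x /hadd_setP[a [b [Aa Bb abx]]]; apply/hadd_setP.
by exists a, b; split; [exact: sA | exact: sB |].
Qed.

Lemma hadd_setC : commutative hadd_set.
Proof.
move=> A B; apply/seteqP; split=> x /hadd_setP[a [b [Aa Bb abx]]];
  by apply/hadd_setP; exists b, a; rewrite haddC.
Qed.

Lemma hadd_set0 : left_id [set hzero] hadd_set.
Proof.
move=> A; apply/seteqP; split=> x.
  by case/hadd_setP=> _ [b [-> Bb]]; rewrite hadd0 => ->.
by move=> Ax; apply/hadd_setP; exists hzero, x; rewrite hadd0.
Qed.

Lemma hadd_setA : associative hadd_set.
Proof.
move=> A B C; apply/seteqP; split=> x /hadd_setP[].
  move=> a [y [Aa /hadd_setP[b [c [Bb Cc bcy]]] ayx]].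
  have: hyperop_set hadd [set a] (hadd b c) x by exists a => //; exists y.
  rewrite -haddA => /hadd_setP[y' [_ [aby' -> y'cx]]].
  by apply/hadd_setP; exists y', c; split=> //; apply/hadd_setP; exists a, b.
move=> y [c [/hadd_setP[a [b [Aa Bb aby]]] Cc ycx]].
have: hyperop_set hadd (hadd a b) [set c] x by exists y => //; exists c.
rewrite haddA => /hadd_setP[_ [y' [-> bcy' ay'x]]].
by apply/hadd_setP; exists a, y'; split=> //; apply/hadd_setP; exists b, c.
Qed.

(** Gives hypersums the generic lemmas on iterated operations: splitting, reindexing and permuting
    of terms. *)
HB.instance Definition _ :=
  Monoid.isComLaw.Build (set H) [set hzero] hadd_set
    hadd_setA hadd_setC hadd_set0.

Lemma hsumE (s : seq H) :
  hsum s = \big[hadd_set/[set hzero]]_(a <- s) [set a].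
Proof. by elim: s => [|a s IHs]; rewrite ?big_nil // big_cons /= IHs. Qed.

Lemma hadd_set_mull x (A B : set H) :
  hmul x @` hadd_set A B = hadd_set (hmul x @` A) (hmul x @` B).
Proof.
apply/seteqP; split=> y.
  case=> z /hadd_setP[a [b [Aa Bb abz]]] <-; apply/hadd_setP.
  exists (hmul x a), (hmul x b); split; [by exists a | by exists b |].
  by rewrite -hmul_addr; exists z.
case/hadd_setP=> _ [_ [[a Aa <-] [b Bb <-]]]; rewrite -hmul_addr => -[z abz <-].
by exists z => //; apply/hadd_setP; exists a, b.
Qed.

Lemma hoppK : involutive (@hopp H).
Proof. by move=> a; apply/esym/hoppP; rewrite haddC; apply/hoppP. Qed.

End SetHypersum.

Section FieldHom.
Variables (F : fieldType) (H : hyperfield).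
Variable f : hyperfield_hom (field_hyperfield F) H.

Lemma hom0 : f 0 = hzero. Proof. exact: (hf_hzero f). Qed.

Lemma homM (x y : F) : f (x * y) = hmul (f x) (f y).
Proof. exact: (hf_hmul f). Qed.

Lemma homD (x y : F) : hadd (f x) (f y) (f (x + y)).
Proof. by apply: (@hf_hadd _ _ f x y); exists (x + y). Qed.

Lemma homN (x : F) : f (- x) = hopp (f x).
Proof. by apply/hoppP; rewrite -hom0 -(subrr x); exact: homD. Qed.

Lemma hom_exp (x : F) n : hexp (f x) n = f (x ^+ n).
Proof.
elim: n => [|n IHn]; first exact: (esym (hf_hone f)).
by rewrite exprS homM -IHn.
Qed.

Lemma hom_image_hmul I (r : seq I) (P : pred I) x (G : I -> F) :
  hmul (f x) @` (\big[@hadd_set H/[set hzero]]_(i <- r | P i) [set f (G i)]) =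
  \big[@hadd_set H/[set hzero]]_(i <- r | P i) [set f (x * G i)].
Proof.
(* The axiom [hmul0] has the zero on the left; writing [hzero] as [f 0] moves the product into
   [F]. *)
have im0 : hmul (f x) @` [set hzero] = [set hzero].
  by rewrite image_set1 -hom0 -homM mulr0.
rewrite (big_morph (fun A => hmul (f x) @` A) (hadd_set_mull (f x)) im0).
by apply: eq_bigr => i _; rewrite image_set1 -homM.
Qed.

(** * Evaluating a pushed-forward product of linear factors *)

(** The length [n] is free: zero coefficients only add the neutral [hzero], so hypersums can be
    padded to a common length. *)
Definition push_horner (n : nat) (q : {poly F}) (x : F) : set H :=
  \big[@hadd_set H/[set hzero]]_(i < n) [set f (q`_i * x ^+ i)].

Lemma push_horner_mulXsubC n (q : {poly F}) (r x : F) : (size q <= n)%N ->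
  push_horner n.+1 (q * ('X - r%:P)) x `<=`
  hadd_set (hmul (f x) @` push_horner n q x)
           (hmul (f (- r)) @` push_horner n q x).
Proof.
move=> szq; rewrite /push_horner !hom_image_hmul.
(* Multiplying by [x] shifts the indices up by one; the new constant term is zero. *)
have -> : \big[@hadd_set H/[set hzero]]_(i < n) [set f (x * (q`_i * x ^+ i))] =
    \big[@hadd_set H/[set hzero]]_(i < n.+1) [set f ((q * 'X)`_i * x ^+ i)].
  rewrite big_ord_recl coefMX mul0r hom0 Monoid.mul1m.
  by apply: eq_bigr => i _; rewrite coefMX /= exprS mulrCA.
(* Padding at the top: the coefficient of index [n] vanishes by the size bound. *)
have -> :
    \big[@hadd_set H/[set hzero]]_(i < n) [set f (- r * (q`_i * x ^+ i))] =
    \big[@hadd_set H/[set hzero]]_(i < n.+1) [set f (- r * (q`_i * x ^+ i))].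
  by rewrite big_ord_recr /= nth_default // mul0r mulr0 hom0 Monoid.mulm1.
(* With equal lengths the two hypersums merge, and the inclusion is checked term by term. *)
rewrite -big_split; apply: (big_ind2 (fun A B : set H => A `<=` B)) => //.
  by move=> *; exact: hadd_setS.
move=> i _ _ -> /=; rewrite hadd_set1.
rewrite mulrBr coefB coefMC mulrBl.
by rewrite mulrA mulNr mulNr (mulrC r); exact: homD.
Qed.

Lemma push_horner_prod_XsubC (c x : F) (rs : seq F) :
    surjective_hom f -> stringent H ->
    c != 0 -> (forall r, r \in rs -> f r <> f x) ->
  exists2 s, s <> hzero & push_horner (size rs).+1
    (c *: \prod_(r <- rs) ('X - r%:P)) x `<=` [set s].
Proof.
move=> surjf strH c0; elim: rs => [|r rs IHrs] neq_f.
  exists (f c); first by apply: hyperfield_hom_neq0; exact/eqP.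
  rewrite /push_horner big_ord_recl big_ord0 Monoid.mulm1 big_nil.
  by rewrite alg_polyC coefC mulr1.
have [|s s0 sub_s] := IHrs.
  by move=> r' r's; apply: neq_f; rewrite inE r's orbT.
(* This makes [f x] and [f (- r)] non-opposite, so their hypersum is a singleton and its element [t]
   is nonzero. *)
have neq_r : f x <> hopp (f (- r)).
  by rewrite homN hoppK; apply/nesym/neq_f; rewrite mem_head.
have [t addt] := strH _ _ neq_r.
exists (hmul s t).
  apply: hmul_neq0 => // t0; apply: neq_r.
  by apply/hoppP; rewrite haddC addt t0.
rewrite big_cons [_ * \prod_(_ <- _) _]mulrC scalerAl.
set q := _ *: _ in sub_s *.
have szq : (size q <= (size rs).+1)%N by rewrite size_scale // size_prod_XsubC.
move=> y /(push_horner_mulXsubC szq)/hadd_setP[_ [_ [[u /sub_s -> <-] [v /sub_s -> <-]]]].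
(* [hmulC] requires nonzero factors, but [f x] or [f (- r)] may be zero; lifting [s] to [F] lets the
   products commute there. *)
have [w _ fw] := surjf s I.
have hmul_s a : hmul (f a) s = hmul s (f a) by rewrite -fw -!homM mulrC.
by rewrite !hmul_s -hmul_addr addt image_set1.
Qed.

(** * From formal hyperfield polynomials to ordinary polynomials *)

Lemma hsum_field (s : seq F) :
  hsum (s : seq (field_hyperfield F)) = [set (\sum_(x <- s) x : F)].
Proof.
elim: s => [|x s IHs]; rewrite ?big_nil // big_cons /= IHs.
exact: (hadd_set1 (x : field_hyperfield F)).
Qed.

Definition poly_of_hpoly (p : hpoly (field_hyperfield F)) : {poly F} :=
  \sum_(d : hp_supp p) (hp_coef d : F) *: 'X^(val d).

Lemma hexp_field (x : F) n : hexp (x : field_hyperfield F) n = x ^+ n.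
Proof. by elim: n => //= n IHn; rewrite exprS -IHn. Qed.

Lemma hp_eval_field (p : hpoly (field_hyperfield F)) (x : F) :
  hp_eval p x = [set (poly_of_hpoly p).[x]].
Proof.
rewrite /hp_eval hsum_field big_map big_enum horner_sum; congr [set _].
by apply: eq_bigr => d _; rewrite !hornerE hexp_field.
Qed.

Lemma coef_poly_of_hpoly (p : hpoly (field_hyperfield F)) (d : hp_supp p) :
  (poly_of_hpoly p)`_(val d) = hp_coef d.
Proof.
rewrite coef_sum (bigD1 d) //= coefZ coefXn eqxx mulr1 big1 ?addr0 // => e ne.
by rewrite coefZ coefXn (inj_eq val_inj) eq_sym (negPf ne) mulr0.
Qed.

Lemma coef_poly_of_hpoly0 (p : hpoly (field_hyperfield F)) i :
  i \notin hp_supp p -> (poly_of_hpoly p)`_i = 0.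
Proof.
move=> pi; rewrite coef_sum big1 // => e _; rewrite coefZ coefXn.
case: eqP => [ei|]; last by rewrite mulr0.
by rewrite ei (valP e) in pi.
Qed.

(** The left side runs over the support, the right side over all indices below the size. Nonzero
    coefficients keep the support below the size, and the other indices contribute [f 0]. *)
Lemma hp_eval_push (p : hpoly (field_hyperfield F)) (x : F) :
  hp_eval (hp_push f p) (f x) =
  push_horner (size (poly_of_hpoly p)) (poly_of_hpoly p) x.
Proof.
rewrite /hp_eval hsumE big_map big_enum /push_horner.
set q := poly_of_hpoly p.
under eq_bigr => d _.
  rewrite hom_exp -homM -coef_poly_of_hpoly -/q.
  over.
rewrite -(big_seq_fsetE _ (hp_supp p) xpredT (fun i => [set f (q`_i * x ^+ i)])).
rewrite -(big_mkord xpredT (fun i => [set f (q`_i * x ^+ i)])) /=.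
have supp_size i : i \in hp_supp p -> (i < size q)%N.
  move=> pi; rewrite ltnNge; apply/negP => szi.
  apply: (@hp_coef_neq0 _ p [` pi]%fset).
  by rewrite -coef_poly_of_hpoly nth_default.
rewrite [RHS](bigID (mem (hp_supp p)) xpredT) /= [X in hadd_set _ X]big1 ?Monoid.mulm1.
  rewrite -[RHS]big_filter; apply: perm_big; apply: uniq_perm.
  - exact: fset_uniq.
  - exact/filter_uniq/iota_uniq.
  move=> i; rewrite mem_filter mem_index_iota /=.
  by apply/idP/andP => [pi|[]//]; split=> //; exact: supp_size.
by move=> i pi; rewrite coef_poly_of_hpoly0 // mul0r hom0.
Qed.

End FieldHom.

Theorem corollary3p13 (F : closedFieldType) (H : hyperfield)
    (f : hyperfield_hom (field_hyperfield F) H) :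
  surjective_hom f -> stringent H -> relatively_algebraically_closed f.
Proof.
move=> surjf strH; split=> // p b; have [x _ <-] := surjf b I.
rewrite /hp_roots /= hp_eval_push => rootb.
(* Every point is a root of the zero polynomial, so the chosen preimage [x] works. *)
have [q0|q0] := eqVneq (poly_of_hpoly p) 0.
  by exists x => //=; rewrite hp_eval_field q0 horner0.
have [rs def_q] := closed_field_poly_normal (poly_of_hpoly p).
have lc0 : lead_coef (poly_of_hpoly p) != 0 by rewrite lead_coef_eq0.
case: (pselect (exists2 r, r \in rs & f r = f x)) => [[r rs_r fr]|no_r].
  exists r => //=; rewrite hp_eval_field def_q hornerZ /=.
  have /rootP -> : root (\prod_(z <- rs) ('X - z%:P)) r.
    by rewrite root_prod_XsubC.
  by rewrite mulr0.
(* Without a root above [f x], the evaluation lies in a nonzero singleton, against [rootb]. *)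
have [|s s0] := push_horner_prod_XsubC surjf strH lc0 (rs := rs) (x := x).
  by move=> r rs_r fr; apply: no_r; exists r.
have szq : size (poly_of_hpoly p) = (size rs).+1.
  by rewrite def_q size_scale // size_prod_XsubC.
by rewrite -def_q -szq => /(_ _ rootb) /esym.
Qed.
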